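(* Let $\mathcal{A}\in\mathbb{R}^{I\times J\times K}$, let the positive integer $R$ be an upper bound of $\mathrm{rank}(\mathcal{A})$, let $\lambda>0$ and $s>1$, and let $\bm{\omega}^n=(\mathbf{X}^n,\mathbf{Y}^n,\mathbf{Z}^n,\bm{\alpha}^n)$, $n\in\mathbb{N}$, be a sequence generated by the LRAT algorithm with parameters $R,\lambda,s$. Then: (i) the sequence $\{\Psi(\bm{\omega}^n)\}_{n\in\mathbb{N}}$ is nonincreasing, and for any $n\in\mathbb{N}$ there is a scalar $\beta>0$ such that $\Psi(\bm{\omega}^{n})-\Psi(\bm{\omega}^{n+1})\geq\beta\|\bm{\omega}^n-\bm{\omega}^{n+1}\|_F^2$; (ii) $\lim_{n\to\infty}\|\mathbf{X}^n-\mathbf{X}^{n+1}\|_F=0$, $\lim_{n\to\infty}\|\mathbf{Y}^n-\mathbf{Y}^{n+1}\|_F=0$, $\lim_{n\to\infty}\|\mathbf{Z}^n-\mathbf{Z}^{n+1}\|_F=0$ and $\lim_{n\to\infty}\|\bm{\alpha}^n-\bm{\alpha}^{n+1}\|_F=0$; (iii) the sequence $\{\bm{\omega}^n\}_{n\in\mathbb{N}}$ is bounded.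
   Context: Notation. For $\mathbf{X}=(\mathbf{x}_1,\dots,\mathbf{x}_R)\in\mathbb{R}^{I\times R}$, $\mathbf{Y}=(\mathbf{y}_1,\dots,\mathbf{y}_R)\in\mathbb{R}^{J\times R}$, $\mathbf{Z}=(\mathbf{z}_1,\dots,\mathbf{z}_R)\in\mathbb{R}^{K\times R}$ and a row vector $\bm{\alpha}=(\alpha_1,\dots,\alpha_R)\in\mathbb{R}^R$, set $[\bm{\alpha};\mathbf{X},\mathbf{Y},\mathbf{Z}]_R=\sum_{r=1}^R\alpha_r\,\mathbf{x}_r\circ\mathbf{y}_r\circ\mathbf{z}_r$, where $\mathbf{x}\circ\mathbf{y}\circ\mathbf{z}$ is the tensor with entries $x_iy_jz_k$. The rank of $\mathcal{A}$ is the minimal number of such outer products summing to $\mathcal{A}$. $\|\cdot\|_F$ is the Frobenius norm (Euclidean norm for vectors; for tuples $\bm{\omega}$ the square root of the sum of squares of all entries), $\|\bm{\alpha}\|_1=\sum_r|\alpha_r|$. Let $S_1,S_2,S_3$ be the sets of matrices in $\mathbb{R}^{I\times R},\mathbb{R}^{J\times R},\mathbb{R}^{K\times R}$, respectively, all of whose columns have Euclidean norm one, and $\delta_S$ the indicator function ($0$ on $S$, $+\infty$ off $S$). Put $f(\mathbf{X},\mathbf{Y},\mathbf{Z},\bm{\alpha})=\frac12\|\mathcal{A}-[\bm{\alpha};\mathbf{X},\mathbf{Y},\mathbf{Z}]_R\|_F^2$, $g(\bm{\alpha})=\lambda\|\bm{\alpha}\|_1$ and, for $\bm{\omega}=(\mathbf{X},\mathbf{Y},\mathbf{Z},\bm{\alpha})$,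 $$\Psi(\bm{\omega})=f(\mathbf{X},\mathbf{Y},\mathbf{Z},\bm{\alpha})+g(\bm{\alpha})+\delta_{S_1}(\mathbf{X})+\delta_{S_2}(\mathbf{Y})+\delta_{S_3}(\mathbf{Z}).$$ The Khatri-Rao product is $\mathbf{X}\odot\mathbf{Y}=(\mathbf{x}_1\otimes\mathbf{y}_1,\dots,\mathbf{x}_R\otimes\mathbf{y}_R)$ with $\otimes$ the Kronecker product. With $\mathbf{D}_{\bm\alpha}=\mathrm{diag}(\alpha_1,\dots,\alpha_R)$, put $\mathbf{U}=\mathbf{D}_{\bm\alpha}(\mathbf{Z}\odot\mathbf{Y})^T$, $\mathbf{V}=\mathbf{D}_{\bm\alpha}(\mathbf{Z}\odot\mathbf{X})^T$, $\mathbf{W}=\mathbf{D}_{\bm\alpha}(\mathbf{Y}\odot\mathbf{X})^T$, and let $\mathbf{Q}\in\mathbb{R}^{R\times IJK}$ be the matrix whose $r$-th row is the vectorization of $\mathbf{x}_r\circ\mathbf{y}_r\circ\mathbf{z}_r$. LRAT algorithm. Input: $\mathcal{A}$, $R$ (upper bound of $\mathrm{rank}(\mathcal{A})$), $\lambda$, $s>1$. Start from $(\mathbf{X}^0,\mathbf{Y}^0,\mathbf{Z}^0,\bm{\alpha}^0)$ with $\mathbf{X}^0\in S_1$, $\mathbf{Y}^0\in S_2$, $\mathbf{Z}^0\in S_3$. For $n=0,1,2,\dots$: (1) $\mathbf{U}^n$ is $\mathbf{U}$ computed from $(\bm{\alpha}^n,\mathbf{Y}^n,\mathbf{Z}^n)$,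 $d_n=\max\{\|\mathbf{U}^n{\mathbf{U}^n}^T\|_F,1\}$, $\mathbf{D}^n=\mathbf{X}^n-\frac{1}{sd_n}\nabla_{\mathbf{X}}f(\mathbf{X}^n,\mathbf{Y}^n,\mathbf{Z}^n,\bm{\alpha}^n)$, and $\mathbf{X}^{n+1}$ is obtained from $\mathbf{D}^n$ by dividing each column by its Euclidean norm. (2) $\mathbf{V}^n$ is $\mathbf{V}$ computed from $(\bm{\alpha}^n,\mathbf{X}^{n+1},\mathbf{Z}^n)$, $e_n=\max\{\|\mathbf{V}^n{\mathbf{V}^n}^T\|_F,1\}$, $\mathbf{E}^n=\mathbf{Y}^n-\frac{1}{se_n}\nabla_{\mathbf{Y}}f(\mathbf{X}^{n+1},\mathbf{Y}^n,\mathbf{Z}^n,\bm{\alpha}^n)$, and $\mathbf{Y}^{n+1}$ is obtained from $\mathbf{E}^n$ by dividing each column by its norm. (3) $\mathbf{W}^n$ is $\mathbf{W}$ computed from $(\bm{\alpha}^n,\mathbf{X}^{n+1},\mathbf{Y}^{n+1})$, $f_n=\max\{\|\mathbf{W}^n{\mathbf{W}^n}^T\|_F,1\}$, $\mathbf{F}^n=\mathbf{Z}^n-\frac{1}{sf_n}\nabla_{\mathbf{Z}}f(\mathbf{X}^{n+1},\mathbf{Y}^{n+1},\mathbf{Z}^n,\bm{\alpha}^n)$, and $\mathbf{Z}^{n+1}$ is obtained from $\mathbf{F}^n$ by dividing each column by its norm. (4) $\mathbf{Q}^{n+1}$ is $\mathbf{Q}$ computed from $(\mathbf{X}^{n+1},\mathbf{Y}^{n+1},\mathbf{Z}^{n+1})$,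 $\eta_n=\max\{\|\mathbf{Q}^{n+1}{\mathbf{Q}^{n+1}}^T\|_F,1\}$, $\bm{\beta}^{n+1}=\bm{\alpha}^n-\frac{1}{s\eta_n}\nabla_{\bm{\alpha}}f(\mathbf{X}^{n+1},\mathbf{Y}^{n+1},\mathbf{Z}^{n+1},\bm{\alpha}^n)$, and $\bm{\alpha}^{n+1}=\mathcal{S}_{\lambda/(s\eta_n)}(\bm{\beta}^{n+1})$, where $\mathcal{S}_\tau$ is componentwise soft thresholding, $\mathcal{S}_\tau(t)=\mathrm{sgn}(t)\max\{|t|-\tau,0\}$. A sequence generated by the algorithm is understood to be one for which all columns of $\mathbf{D}^n,\mathbf{E}^n,\mathbf{F}^n$ are nonzero, so that the normalizations are defined. *)

(* Defs.v *)
From HB Require Import structures.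
From mathcomp Require Import all_boot all_order all_algebra.
From mathcomp Require Import all_classical all_reals all_analysis.
From mathcomp.real_closed Require Import mxtens.

Set Implicit Arguments.
Unset Strict Implicit.
Unset Printing Implicit Defensive.

Import Order.TTheory GRing.Theory Num.Theory.
Import numFieldNormedType.Exports.
Local Open Scope classical_set_scope.
Local Open Scope ring_scope.

Notation tensor R I J K := {ffun 'I_I * 'I_J * 'I_K -> R}.

Section Norms.
Variable R : realType.

Definition sumsq (m n : nat) (M : 'M[R]_(m, n)) : R :=
  \sum_i \sum_j M i j ^+ 2.

(* MathComp-Analysis norms matrices by `|M|, the maximum of the absolute
   values of the entries, hence this separate Frobenius norm. *)
Definition frob (m n : nat) (M : 'M[R]_(m, n)) : R := Num.sqrt (sumsq M).

Definition frob_tensor (I J K : nat) (T : tensor R I J K) : R :=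
  Num.sqrt (\sum_p T p ^+ 2).

Definition l1norm (m : nat) (a : 'rV[R]_m) : R := \sum_r `|a 0 r|.

End Norms.

Section Tensors.
Variables (R : realType) (I J K : nat).

Definition outer (x : 'cV[R]_I) (y : 'cV[R]_J) (z : 'cV[R]_K) :
    tensor R I J K :=
  [ffun p => x p.1.1 0 * y p.1.2 0 * z p.2 0].

Definition sum_of_outer (T : tensor R I J K) (m : nat) : Prop :=
  exists (X : 'M[R]_(I, m)) (Y : 'M[R]_(J, m)) (Z : 'M[R]_(K, m)),
    T = \sum_(r < m) outer (col r X) (col r Y) (col r Z).

Lemma sum_of_outer_ex (T : tensor R I J K) : exists m, `[< sum_of_outer T m >].
Proof.
pose P := ('I_I * 'I_J * 'I_K)%type.
exists #|{: P}|; apply/asboolP.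
exists (\matrix_(i, r) (T (enum_val r) * (i == (enum_val r).1.1)%:R)).
exists (\matrix_(j, r) (j == (enum_val r).1.2)%:R).
exists (\matrix_(k, r) (k == (enum_val r).2)%:R).
apply/ffunP => p; rewrite sum_ffunE (bigD1 (enum_rank p)) //= big1 => [|r rp].
  by rewrite !ffunE !mxE enum_rankK !eqxx !mulr1 addr0.
have {}rp : p != enum_val r.
  by apply: contraNneq rp => ->; rewrite enum_valK.
rewrite !ffunE !mxE -!mulrA; case: eqP => [e1|_]; last by rewrite !(mul0r, mulr0).
case: eqP => [e2|_]; last by rewrite !(mul0r, mulr0).
case: eqP => [e3|_]; last by rewrite !mulr0.
by case/eqP: rp; move: e1 e2 e3; case: (enum_val r) p => -[i j] k [[? ?] ?] /= -> -> ->.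
Qed.

Definition tensor_rank (T : tensor R I J K) : nat := ex_minn (sum_of_outer_ex T).

(* [alpha; X, Y, Z]_N *)
Definition cpd (N : nat) (alpha : 'rV[R]_N)
    (X : 'M[R]_(I, N)) (Y : 'M[R]_(J, N)) (Z : 'M[R]_(K, N)) : tensor R I J K :=
  \sum_r alpha 0 r *: outer (col r X) (col r Y) (col r Z).

(* First index fastest, so that the rows of [Qmx] below are the transposed
   columns of Z (.) Y (.) X; the size K * J * I is the product I * J * K. *)
Definition vectorize (T : tensor R I J K) : 'rV[R]_(K * J * I) :=
  \row_l let kj := mxtens_unindex (mxtens_unindex l).1 in
         T ((mxtens_unindex l).2, kj.2, kj.1).

End Tensors.

Section Matrices.
Variable R : realType.

Definition khatri_rao (m n N : nat) (X : 'M[R]_(m, N)) (Y : 'M[R]_(n, N)) :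
    'M[R]_(m * n, N) :=
  \matrix_(l, r) tensmx (col r X) (col r Y) l 0.

(* diag(alpha) (A (.) B)^T, the common shape of U, V and W *)
Definition scaled_kr (m n N : nat) (alpha : 'rV[R]_N)
    (A : 'M[R]_(m, N)) (B : 'M[R]_(n, N)) : 'M[R]_(N, m * n) :=
  diag_mx alpha *m (khatri_rao A B)^T.

Definition Qmx (I J K N : nat)
    (X : 'M[R]_(I, N)) (Y : 'M[R]_(J, N)) (Z : 'M[R]_(K, N)) :
    'M[R]_(N, K * J * I) :=
  \matrix_r vectorize (outer (col r X) (col r Y) (col r Z)).

Definition unit_cols (m n : nat) : set 'M[R]_(m, n) :=
  [set M | forall r, frob (col r M) = 1].

Definition normalize_cols (m n : nat) (M : 'M[R]_(m, n)) : 'M[R]_(m, n) :=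
  \matrix_(i, r) (M i r / frob (col r M)).

Definition soft (tau t : R) : R := Num.sg t * Num.max (`|t| - tau) 0.

Definition grad (m n : nat) (F : 'M[R]_(m, n) -> R) (M : 'M[R]_(m, n)) :
    'M[R]_(m, n) :=
  \matrix_(i, j) 'D_(delta_mx i j) F M.

Definition indicator (T : Type) (S : set T) (x : T) : \bar R :=
  if x \in S then 0%E else +oo%E.

End Matrices.

Section Objective.
Variables (R : realType) (I J K N : nat) (A : tensor R I J K) (lambda : R).

Definition fobj (X : 'M[R]_(I, N)) (Y : 'M[R]_(J, N)) (Z : 'M[R]_(K, N))
    (alpha : 'rV[R]_N) : R :=
  2^-1 * frob_tensor (A - cpd alpha X Y Z) ^+ 2.

Definition gobj (alpha : 'rV[R]_N) : R := lambda * l1norm alpha.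

Definition Psi (w : 'M[R]_(I, N) * 'M[R]_(J, N) * 'M[R]_(K, N) * 'rV[R]_N) :
    \bar R :=
  let: (X, Y, Z, alpha) := w in
  ((fobj X Y Z alpha)%:E + (gobj alpha)%:E
   + indicator R (@unit_cols R I N) X + indicator R (@unit_cols R J N) Y
   + indicator R (@unit_cols R K N) Z)%E.

Definition frob_point
    (w : 'M[R]_(I, N) * 'M[R]_(J, N) * 'M[R]_(K, N) * 'rV[R]_N) : R :=
  let: (X, Y, Z, alpha) := w in
  Num.sqrt (sumsq X + sumsq Y + sumsq Z + sumsq alpha).

Variable s : R.

Definition nonzero_cols (m n : nat) (M : 'M[R]_(m, n)) : Prop :=
  forall r, col r M != 0.

(* One pass of the algorithm from (X, Y, Z, alpha) to (X', Y', Z', alpha'). *)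
Definition lrat_step
    (X : 'M[R]_(I, N)) (Y : 'M[R]_(J, N)) (Z : 'M[R]_(K, N)) (alpha : 'rV[R]_N)
    (X' : 'M[R]_(I, N)) (Y' : 'M[R]_(J, N)) (Z' : 'M[R]_(K, N))
    (alpha' : 'rV[R]_N) : Prop :=
  let U := scaled_kr alpha Z Y in
  let d := Num.max (frob (U *m U^T)) 1 in
  let D := X - (s * d)^-1 *: grad (fun M => fobj M Y Z alpha) X in
  let V := scaled_kr alpha Z X' in
  let e := Num.max (frob (V *m V^T)) 1 in
  let E := Y - (s * e)^-1 *: grad (fun M => fobj X' M Z alpha) Y in
  let W := scaled_kr alpha Y' X' in
  let f := Num.max (frob (W *m W^T)) 1 in
  let F := Z - (s * f)^-1 *: grad (fun M => fobj X' Y' M alpha) Z in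
  let Q := Qmx X' Y' Z' in
  let eta := Num.max (frob (Q *m Q^T)) 1 in
  let beta := alpha - (s * eta)^-1 *: grad (fun a => fobj X' Y' Z' a) alpha in
  [/\ nonzero_cols D /\ X' = normalize_cols D,
      nonzero_cols E /\ Y' = normalize_cols E,
      nonzero_cols F /\ Z' = normalize_cols F
    & alpha' = map_mx (soft (lambda / (s * eta))) beta].

Definition lrat_sequence (X : nat -> 'M[R]_(I, N)) (Y : nat -> 'M[R]_(J, N))
    (Z : nat -> 'M[R]_(K, N)) (alpha : nat -> 'rV[R]_N) : Prop :=
  [/\ X 0%N \in @unit_cols R I N, Y 0%N \in @unit_cols R J N,
      Z 0%N \in @unit_cols R K N
    & forall n, lrat_step (X n) (Y n) (Z n) (alpha n)
                          (X n.+1) (Y n.+1) (Z n.+1) (alpha n.+1)].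

End Objective.

(* Main.v *)
Require Import Defs.
From mathcomp Require Import all_boot all_order all_algebra.
From mathcomp Require Import all_classical all_reals all_analysis.
From mathcomp.real_closed Require Import mxtens.
From mathcomp Require Import ring lra.

Set Implicit Arguments.
Unset Strict Implicit.
Unset Printing Implicit Defensive.

Import Order.TTheory GRing.Theory Num.Theory.
Import numFieldNormedType.Exports.
Local Open Scope classical_set_scope.
Local Open Scope ring_scope.

(** With all blocks but one fixed, f is a linear least-squares function
    M |-> 1/2 ||B - M U||^2, where B is an unfolding of A and U is the matrix
    U, V, W or Q of the algorithm. Its second-order part is
    1/2 ||H U||^2 <= 1/2 ||U U^T||_F ||H||^2, while each update is a proximal
    step of length 1/(s c), with c = max(||U U^T||_F, 1), for the indicator of
    the unit-column matrices or for lambda ||.||_1. A proximal step therefore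
    decreases the objective by at least (s - 1) c / 2 ||H||^2, so that
    beta = (s - 1) / 2 works for every n. As Psi is nonnegative, telescoping
    makes the increments vanish, and lambda ||alpha^n||_1 <= Psi(omega^0)
    bounds the iterates. *)

(** * Frobenius inner product and norm estimates *)

Section Frobenius.
Variable R : realType.

(** Lagrange's identity: twice the gap is the sum of the squares [(a t * b u - a u * b t) ^+ 2] over
    all pairs. *)
Lemma cauchy_schwarz_sum (T : finType) (a b : T -> R) :
  (\sum_t a t * b t) ^+ 2 <= (\sum_t a t ^+ 2) * (\sum_t b t ^+ 2).
Proof.
have sum2 (f g : T -> R) :
    (\sum_t f t) * (\sum_t g t) = \sum_t \sum_u f t * g u.
  by rewrite mulr_suml; apply: eq_bigr => t _; rewrite mulr_sumr.
have : 0 <= \sum_t \sum_u (a t * b u - a u * b t) ^+ 2.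
  by do 2!apply: sumr_ge0 => ? _; apply: sqr_ge0.
have -> : \sum_t \sum_u (a t * b u - a u * b t) ^+ 2 =
    2 * ((\sum_t a t ^+ 2) * (\sum_t b t ^+ 2) - (\sum_t a t * b t) ^+ 2).
  rewrite mulrBr mulr_natl mulr2n {2}[_ * (\sum_t b t ^+ 2)]mulrC expr2 !sum2.
  rewrite mulr_sumr -big_split -sumrB; apply: eq_bigr => t _ /=.
  rewrite mulr_sumr -big_split -sumrB; apply: eq_bigr => u _ /=; ring.
by rewrite pmulr_rge0 ?ltr0n // subr_ge0.
Qed.

(** The Frobenius inner product; in trace form, bilinearity and adjoints come from matrix
    algebra. *)
Definition dot (m n : nat) (A B : 'M[R]_(m, n)) : R := \tr (A *m B^T).

Lemma dotE (m n : nat) (A B : 'M[R]_(m, n)) :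
  dot A B = \sum_i \sum_j A i j * B i j.
Proof.
by apply: eq_bigr => i _; rewrite mxE; apply: eq_bigr => j _; rewrite mxE.
Qed.

Lemma sumsqE (m n : nat) (A : 'M[R]_(m, n)) : sumsq A = dot A A.
Proof.
by rewrite dotE; do 2!apply: eq_bigr => ? _; rewrite expr2.
Qed.

Lemma dotC (m n : nat) (A B : 'M[R]_(m, n)) : dot A B = dot B A.
Proof. by rewrite !dotE; do 2!apply: eq_bigr => ? _; rewrite mulrC. Qed.

Lemma dotDl (m n : nat) (A B C : 'M[R]_(m, n)) :
  dot (A + B) C = dot A C + dot B C.
Proof. by rewrite /dot mulmxDl mxtraceD. Qed.

Lemma dotZl (m n : nat) (a : R) (A B : 'M[R]_(m, n)) :
  dot (a *: A) B = a * dot A B.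
Proof. by rewrite /dot -scalemxAl mxtraceZ. Qed.

Lemma dotNl (m n : nat) (A B : 'M[R]_(m, n)) : dot (- A) B = - dot A B.
Proof. by rewrite -scaleN1r dotZl mulN1r. Qed.

(** Right multiplication by [U^T] is the adjoint of right multiplication by [U]; this produces the
    least-squares gradient. *)
Lemma dot_mulmxr (m n q : nat) (A : 'M[R]_(m, q)) (H : 'M[R]_(m, n))
    (U : 'M[R]_(n, q)) :
  dot A (H *m U) = dot (A *m U^T) H.
Proof. by rewrite /dot trmx_mul mulmxA. Qed.

Lemma dot_delta (m n : nat) (A : 'M[R]_(m, n)) i j :
  dot A (delta_mx i j) = A i j.
Proof.
rewrite dotE (bigD1 i) //= (bigD1 j) //= !mxE !eqxx mulr1 !big1 ?addr0 //.
- by move=> k /negPf ki; apply: big1 => l _; rewrite mxE ki mulr0.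
- by move=> l /negPf lj; rewrite mxE lj andbF mulr0.
Qed.

Lemma sumsq_ge0 (m n : nat) (A : 'M[R]_(m, n)) : 0 <= sumsq A.
Proof. by do 2!apply: sumr_ge0 => ? _; apply: sqr_ge0. Qed.

Lemma sumsqD (m n : nat) (A B : 'M[R]_(m, n)) :
  sumsq (A + B) = sumsq A + 2 * dot A B + sumsq B.
Proof.
rewrite !sumsqE !dotDl ![dot _ (A + B)]dotC !dotDl [dot B A]dotC; ring.
Qed.

Lemma sumsqZ (m n : nat) (a : R) (A : 'M[R]_(m, n)) :
  sumsq (a *: A) = a ^+ 2 * sumsq A.
Proof. by rewrite !sumsqE dotZl dotC dotZl mulrA. Qed.

Lemma sumsqN (m n : nat) (A : 'M[R]_(m, n)) : sumsq (- A) = sumsq A.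
Proof. by rewrite -scaleN1r sumsqZ sqrrN expr1n mul1r. Qed.

Lemma sumsq_tr (m n : nat) (A : 'M[R]_(m, n)) : sumsq A^T = sumsq A.
Proof.
by rewrite /sumsq exchange_big; do 2!apply: eq_bigr => ? _; rewrite mxE.
Qed.

Lemma sumsq_cols (m n : nat) (A : 'M[R]_(m, n)) :
  sumsq A = \sum_r sumsq (col r A).
Proof.
rewrite /sumsq exchange_big; apply: eq_bigr => r _; apply: eq_bigr => i _.
by rewrite big_ord1 mxE.
Qed.

Lemma sumsq_eq0 (m n : nat) (A : 'M[R]_(m, n)) : (sumsq A == 0) = (A == 0).
Proof.
apply/eqP/eqP => [A0|->]; last first.
  by rewrite /sumsq !big1 // => i _; rewrite big1 // => j _; rewrite mxE expr0n.
apply/matrixP => i j; rewrite mxE; apply/eqP; rewrite -sqrf_eq0; apply/eqP.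
have row_ge0 k : 0 <= \sum_l A k l ^+ 2.
  by apply: sumr_ge0 => l _; apply: sqr_ge0.
have Ai0 : \sum_l A i l ^+ 2 = 0 by apply: (psumr_eq0P _ A0).
by apply: (psumr_eq0P _ Ai0) => // l _; apply: sqr_ge0.
Qed.

Lemma frob_ge0 (m n : nat) (A : 'M[R]_(m, n)) : 0 <= frob A.
Proof. exact: sqrtr_ge0. Qed.

Lemma frob_sqr (m n : nat) (A : 'M[R]_(m, n)) : frob A ^+ 2 = sumsq A.
Proof. by rewrite sqr_sqrtr // sumsq_ge0. Qed.

Lemma dot_le_frob (m n : nat) (A B : 'M[R]_(m, n)) :
  dot A B <= frob A * frob B.
Proof.
rewrite /frob -sqrtrM ?sumsq_ge0 //.
apply: le_trans (ler_norm _) _; rewrite -sqrtr_sqr ler_wsqrtr //.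
rewrite dotE /sumsq !pair_bigA; exact: cauchy_schwarz_sum.
Qed.

(** Cauchy-Schwarz applied to each entry of the product, a row of [A] against a column of [B]. *)
Lemma sumsq_mulmx (m n q : nat) (A : 'M[R]_(m, n)) (B : 'M[R]_(n, q)) :
  sumsq (A *m B) <= sumsq A * sumsq B.
Proof.
rewrite [sumsq A in leRHS]/sumsq mulr_suml; apply: ler_sum => i _.
rewrite -[sumsq B]sumsq_tr [sumsq _ in leRHS]/sumsq mulr_sumr.
apply: ler_sum => j _; rewrite mxE; apply: le_trans (cauchy_schwarz_sum _ _) _.
rewrite le_eqVlt; apply/orP; left; apply/eqP; congr (_ * _).
by apply: eq_bigr => k _; rewrite mxE.
Qed.

(* ||H U||^2 = <H^T H, U U^T> and ||H^T H|| <= ||H||^2. *)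
Lemma sumsq_mulmx_gram (m n q : nat) (H : 'M[R]_(m, n)) (U : 'M[R]_(n, q)) :
  sumsq (H *m U) <= frob (U *m U^T) * sumsq H.
Proof.
have -> : sumsq (H *m U) = dot (U *m U^T) (H^T *m H).
  by rewrite sumsqE /dot !trmx_mul trmxK -mulmxA mxtrace_mulC !mulmxA.
apply: le_trans (dot_le_frob _ _) _; rewrite ler_wpM2l ?frob_ge0 //.
rewrite -(@ler_pXn2r _ 2) ?nnegrE ?frob_ge0 ?sumsq_ge0 // frob_sqr expr2.
by apply: le_trans (sumsq_mulmx _ _) _; rewrite sumsq_tr.
Qed.

(** Each absolute value times the full l1 norm is at least its own square. *)
Lemma sumsq_rowV_le_l1norm (m : nat) (a : 'rV[R]_m) :
  sumsq a <= l1norm a ^+ 2.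
Proof.
rewrite /sumsq big_ord1 expr2 /l1norm mulr_sumr; apply: ler_sum => r _.
rewrite -real_normK ?num_real // expr2.
by rewrite ler_wpM2r // (bigD1 r) //= lerDl sumr_ge0.
Qed.

End Frobenius.

(** * Proximal gradient steps for least-squares functions *)

Section ProximalDescent.
Variable R : realType.

(** The difference quotient along [v] is [c + t * q], which tends to [c]. *)
Lemma derive_quadratic (V : normedModType R) (f : V -> R) (x v : V) (c q : R) :
  (forall t, f (t *: v + x) = f x + t * c + t ^+ 2 * q) -> 'D_v f x = c.
Proof.
move=> fE; apply: cvg_lim => //.
have lin : c + t * q @[t --> (0 : R)^'] --> c.
  rewrite -[X in _ --> X]addr0 -[X in _ --> _ + X](mul0r q).
  apply: cvgD; first exact: cvg_cst.
  by apply: cvgMl; exact: nbhs_dnbhs.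
apply: cvg_trans lin; apply: near_eq_cvg; near=> t.
have t0 : t != 0 by near: t; exact: nbhs_dnbhs_neq.
by rewrite /= fE /GRing.scale /=; field.
Unshelve. all: by end_near.
Qed.

(** Along each coordinate direction [h] is a quadratic polynomial, and its linear coefficient is the
    gradient entry. *)
Lemma grad_least_squares (m n q : nat) (h : 'M[R]_(m, n) -> R)
    (B : 'M[R]_(m, q)) (U : 'M[R]_(n, q)) :
    (forall M, h M = 2^-1 * sumsq (B - M *m U)) ->
  forall M, grad h M = - ((B - M *m U) *m U^T).
Proof.
move=> hE M; apply/matrixP => i j; rewrite mxE [RHS]mxE.
apply: (derive_quadratic (q := 2^-1 * sumsq (delta_mx i j *m U))) => t.
rewrite [_ *: _ + M]addrC !hE mulmxDl -scalemxAl opprD addrA.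
set C := B - M *m U; rewrite sumsqD sumsqN sumsqZ.
by rewrite dotC dotNl dotZl dotC dot_mulmxr dot_delta; lra.
Qed.

(** Second-order Taylor expansion, exact because [h] is quadratic. *)
Lemma least_squares_expand (m n q : nat) (h : 'M[R]_(m, n) -> R)
    (B : 'M[R]_(m, q)) (U : 'M[R]_(n, q)) :
    (forall M, h M = 2^-1 * sumsq (B - M *m U)) ->
  forall M H, h (M + H) = h M + dot (grad h M) H + 2^-1 * sumsq (H *m U).
Proof.
move=> hE M H; rewrite (grad_least_squares hE) !hE mulmxDl opprD addrA.
set C := B - M *m U; rewrite sumsqD
sumsqN dotNl dotC dotNl dotC dot_mulmxr; lra.
Qed.

(* Comparing the proximal objective at [M'] with its value at [M] and expanding
   both squares leaves <grad h M, M' - M> <= g - g' - s c / 2 ||M' - M||^2. *)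
Lemma prox_descent (m n q : nat) (h : 'M[R]_(m, n) -> R) (B : 'M[R]_(m, q))
    (U : 'M[R]_(n, q)) (s g g' : R) (M M' : 'M[R]_(m, n))
    (c := Num.max (frob (U *m U^T)) 1)
    (D := M - (s * c)^-1 *: grad h M) :
    (forall M, h M = 2^-1 * sumsq (B - M *m U)) -> 1 < s ->
    g' + s * c / 2 * sumsq (M' - D) <= g + s * c / 2 * sumsq (M - D) ->
  h M' + g' + (s - 1) / 2 * sumsq (M - M') <= h M + g.
Proof.
move=> hE s1 prox.
have c1 : 1 <= c by rewrite le_max lexx orbT.
have sc_gt0 : 0 < s * c by rewrite mulr_gt0 //; lra.
pose H := M' - M.
have MD : M - D = (s * c)^-1 *: grad h M by rewrite /D opprB addrC subrK.
have M'D : M' - D = (s * c)^-1 *: grad h M + H.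
  by rewrite -MD /H [RHS]addrC addrA subrK.
rewrite MD M'D sumsqD dotZl in prox.
(* The squared gradient terms on both sides cancel, and in the cross term the step length
   [(s * c)^-1] cancels the weight [s * c]. *)
have {}prox : g' + dot (grad h M) H + s * c / 2 * sumsq H <= g.
  suff scE : s * c / 2 * (2 * ((s * c)^-1 * dot (grad h M) H)) =
             dot (grad h M) H by rewrite !mulrDr scE in prox; lra.
  by field; apply/andP; split; rewrite gt_eqF //; lra.
rewrite -(subrKC M M') -/H (least_squares_expand hE).
rewrite opprD addrA subrr sub0r sumsqN.
have HU : sumsq (H *m U) <= c * sumsq H.
  apply: le_trans (sumsq_mulmx_gram _ _) _.
  by rewrite ler_wpM2r ?sumsq_ge0 // le_max lexx.
(* Since [c] is at least 1, the gain with factor [(s - 1) * c / 2] dominates that with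
   [(s - 1) / 2], which is independent of the iterate. *)
have : 0 <= (s - 1) * (c - 1) * sumsq H.
  by rewrite mulr_ge0 ?sumsq_ge0 // mulr_ge0 //; lra.
lra.
Qed.

Lemma normalize_cols_unit (m n : nat) (D : 'M[R]_(m, n)) :
  nonzero_cols D -> unit_cols (normalize_cols D).
Proof.
move=> D0 r; have Dr : frob (col r D) != 0.
  by rewrite -sqrf_eq0 frob_sqr sumsq_eq0.
have -> : col r (normalize_cols D) = (frob (col r D))^-1 *: col r D.
  by apply/matrixP => i j; rewrite !mxE mulrC.
apply/eqP; rewrite -(@eqrXn2 _ 2) ?frob_ge0 // frob_sqr sumsqZ.
by rewrite -frob_sqr -exprMn mulVf.
Qed.

(** Column by column, both candidates have norm one, so only the inner product with the column of
    [D] matters; by Cauchy-Schwarz it is at most the norm of that column, which normalization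
    attains. *)
Lemma normalize_cols_nearest (m n : nat) (D M : 'M[R]_(m, n)) :
    nonzero_cols D -> unit_cols M ->
  sumsq (normalize_cols D - D) <= sumsq (M - D).
Proof.
move=> D0 M1; rewrite !sumsq_cols; apply: ler_sum => r _.
have Dr : frob (col r D) != 0 by rewrite -sqrf_eq0 frob_sqr sumsq_eq0.
have N1 := normalize_cols_unit D0 r.
have ND : col r D = frob (col r D) *: col r (normalize_cols D).
  by apply/matrixP => i j; rewrite !mxE mulrC divfK.
rewrite !linearB /= !sumsqD !sumsqN -!frob_sqr N1 M1.
rewrite ![dot _ (- _)]dotC !dotNl.
have := dot_le_frob (col r D) (col r M); rewrite M1 mulr1.
have -> : dot (col r D) (col r (normalize_cols D)) = frob (col r D).
  by rewrite {1}ND dotZl -sumsqE -frob_sqr N1 expr1n mulr1.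
lra.
Qed.

(** Below the threshold, t u <= |t| |u| makes 0 optimal. Above it, completing the square at
    [t - tau] for positive [t], or at [t + tau] for negative [t], leaves a nonnegative remainder. *)
Lemma soft_prox (tau t u : R) : 0 <= tau ->
  tau * `|soft tau t| + 2^-1 * (soft tau t - t) ^+ 2 <=
  tau * `|u| + 2^-1 * (u - t) ^+ 2.
Proof.
move=> tau0; rewrite /soft.
have sq0 (x : R) : 0 <= x ^+ 2 := sqr_ge0 x.
have [lt_tau|le_tau] := ltP (`|t| - tau) 0.
  rewrite mulr0 normr0 mulr0 !sub0r add0r sqrrN.
  have : t * u <= `|t| * `|u| by rewrite -normrM ler_norm.
  have : 0 <= (tau - `|t|) * `|u| by rewrite mulr_ge0 //; lra.
  have := sq0 u; lra.
have [t_gt0|t_lt0|t0] := ltgtP t 0; last first.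
- rewrite t0 normr0 in le_tau.
  have -> : tau = 0 by lra.
  by rewrite t0 sgr0 !mul0r add0r subrr expr0n mulr0 add0r mulr_ge0 ?invr_ge0.
- move: le_tau; rewrite gtr0_norm // => le_tau.
  rewrite gtr0_sg // mul1r ger0_norm //.
  have : tau * u <= tau * `|u| by rewrite ler_wpM2l ?ler_norm.
  have := sq0 (u - (t - tau)); lra.
- move: le_tau; rewrite ltr0_norm // => le_tau.
  rewrite ltr0_sg // mulN1r normrN ger0_norm //.
  have : - (tau * u) <= tau * `|u|.
    by rewrite -mulrN ler_wpM2l // -normrN ler_norm.
  have := sq0 (u + (- t - tau)); lra.
Qed.

(** Factoring out [c] separates the objective into coordinates, each an instance of [soft_prox] with
    threshold [lambda / c]. *)
Lemma soft_prox_l1 (m : nat) (lambda c : R) (b a : 'rV[R]_m)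
    (a' := map_mx (soft (lambda / c)) b) : 0 <= lambda -> 0 < c ->
  lambda * l1norm a' + c / 2 * sumsq (a' - b) <=
  lambda * l1norm a + c / 2 * sumsq (a - b).
Proof.
move=> lambda0 c0.
have sumE (v : 'rV[R]_m) : lambda * l1norm v + c / 2 * sumsq (v - b) =
    c * \sum_r (lambda / c * `|v 0 r| + 2^-1 * (v 0 r - b 0 r) ^+ 2).
  rewrite big_split -!mulr_sumr mulrDr !mulrA [c * lambda]mulrC.
  rewrite mulfK ?gt_eqF //.
  rewrite /sumsq big_ord1; congr (_ + _ * _).
  by apply: eq_bigr => r _; rewrite !mxE.
rewrite !sumE ler_pM2l //; apply: ler_sum => r _; rewrite mxE.
by apply: soft_prox; rewrite divr_ge0 // ltW.
Qed.

End ProximalDescent.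

(** * Unfoldings of a third-order tensor *)

Section Unfolding.
Variables (R : realType) (I J K N : nat).
Implicit Type T : tensor R I J K.

Lemma big_mxtens (V : nmodType) (m n : nat) (F : 'I_m * 'I_n -> V) :
  \sum_l F (mxtens_unindex l) = \sum_i \sum_j F (i, j).
Proof.
rewrite pair_bigA (reindex (@mxtens_index m n)) /=; last first.
  by exists (@mxtens_unindex m n) => ? _;
    rewrite (mxtens_indexK, mxtens_unindexK).
by apply: eq_bigr => -[i j] _; rewrite mxtens_indexK.
Qed.

Lemma frob_tensor_sqr T :
  frob_tensor T ^+ 2 = \sum_i \sum_j \sum_k T (i, j, k) ^+ 2.
Proof.
rewrite sqr_sqrtr ?sumr_ge0 // => [|? _]; last exact: sqr_ge0.
by rewrite !pair_bigA; apply: eq_bigr => -[[i j] k].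
Qed.

(** Mode-1 matricization; its columns are ordered as the rows of [khatri_rao Z Y]. The two other
    modes follow the same convention. *)
Definition unfold1 T : 'M[R]_(I, K * J) :=
  \matrix_(i, l) T (i, (mxtens_unindex l).2, (mxtens_unindex l).1).

Definition unfold2 T : 'M[R]_(J, K * I) :=
  \matrix_(j, l) T ((mxtens_unindex l).2, j, (mxtens_unindex l).1).

Definition unfold3 T : 'M[R]_(K, J * I) :=
  \matrix_(k, l) T ((mxtens_unindex l).2, (mxtens_unindex l).1, k).

Lemma sumsq_unfold1 T : sumsq (unfold1 T) = frob_tensor T ^+ 2.
Proof.
rewrite frob_tensor_sqr; apply: eq_bigr => i _; rewrite exchange_big.
rewrite -(big_mxtens (fun kj => T (i, kj.2, kj.1) ^+ 2)).
by apply: eq_bigr => l _; rewrite mxE.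
Qed.

Lemma sumsq_unfold2 T : sumsq (unfold2 T) = frob_tensor T ^+ 2.
Proof.
rewrite frob_tensor_sqr exchange_big; apply: eq_bigr => j _.
rewrite exchange_big -(big_mxtens (fun ki => T (ki.2, j, ki.1) ^+ 2)).
by apply: eq_bigr => l _; rewrite mxE.
Qed.

Lemma sumsq_unfold3 T : sumsq (unfold3 T) = frob_tensor T ^+ 2.
Proof.
rewrite frob_tensor_sqr exchange_big.
under eq_bigr => j _ do rewrite exchange_big.
rewrite exchange_big; apply: eq_bigr => k _.
rewrite -(big_mxtens (fun ji => T (ji.2, ji.1, k) ^+ 2)).
by apply: eq_bigr => l _; rewrite mxE.
Qed.

Lemma sumsq_vectorize T : sumsq (vectorize T) = frob_tensor T ^+ 2.
Proof.
rewrite -sumsq_unfold3 /sumsq big_ord1 exchange_big.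
under [RHS]eq_bigr => l _ do under eq_bigr => k _ do rewrite mxE.
rewrite (big_mxtens (fun ji => \sum_k T (ji.2, ji.1, k) ^+ 2)).
under [RHS]eq_bigr => j _ do rewrite exchange_big.
rewrite [RHS]exchange_big.
(* The sums now run over k, j, i from the outside in, matching the nested encoding of [vectorize]: k
   and j are packed first, then i. *)
pose F (kj : 'I_K * 'I_J) := \sum_i T (i, kj.2, kj.1) ^+ 2.
rewrite -(big_mxtens F) /F.
pose G (a : 'I_(K * J) * 'I_I) :=
  T (a.2, (mxtens_unindex a.1).2, (mxtens_unindex a.1).1) ^+ 2.
rewrite -(big_mxtens G).
by apply: eq_bigr => l _; rewrite mxE.
Qed.

Variables (A : tensor R I J K).
Variables (X : 'M[R]_(I, N)) (Y : 'M[R]_(J, N)) (Z : 'M[R]_(K, N)).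
Variable alpha : 'rV[R]_N.

Lemma cpdE i j k :
  cpd alpha X Y Z (i, j, k) = \sum_r alpha 0 r * (X i r * Y j r * Z k r).
Proof.
by rewrite sum_ffunE; apply: eq_bigr => r _; rewrite !ffunE /= !mxE.
Qed.

Lemma scaled_krE (m n : nat) (B : 'M[R]_(m, N)) (C : 'M[R]_(n, N)) r l :
  scaled_kr alpha B C r l =
  alpha 0 r * (B (mxtens_unindex l).1 r * C (mxtens_unindex l).2 r).
Proof. by rewrite /scaled_kr mul_diag_mx !mxE. Qed.

(** Unfolding preserves the norm and turns the sum of outer products into a matrix product with [X],
    the form that [prox_descent] takes as hypothesis. The other blocks are treated alike. *)
Lemma fobj_unfold1 :
  fobj A X Y Z alpha = 2^-1 * sumsq (unfold1 A - X *m scaled_kr alpha Z Y).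
Proof.
rewrite /fobj -sumsq_unfold1; congr (_ * sumsq _).
apply/matrixP => i l; rewrite !mxE !ffunE cpdE; congr (_ - _).
by apply: eq_bigr => r _; rewrite scaled_krE; ring.
Qed.

Lemma fobj_unfold2 :
  fobj A X Y Z alpha = 2^-1 * sumsq (unfold2 A - Y *m scaled_kr alpha Z X).
Proof.
rewrite /fobj -sumsq_unfold2; congr (_ * sumsq _).
apply/matrixP => j l; rewrite !mxE !ffunE cpdE; congr (_ - _).
by apply: eq_bigr => r _; rewrite scaled_krE; ring.
Qed.

Lemma fobj_unfold3 :
  fobj A X Y Z alpha = 2^-1 * sumsq (unfold3 A - Z *m scaled_kr alpha Y X).
Proof.
rewrite /fobj -sumsq_unfold3; congr (_ * sumsq _).
apply/matrixP => k l; rewrite !mxE !ffunE cpdE; congr (_ - _).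
by apply: eq_bigr => r _; rewrite scaled_krE; ring.
Qed.

Lemma fobj_vectorize :
  fobj A X Y Z alpha = 2^-1 * sumsq (vectorize A - alpha *m Qmx X Y Z).
Proof.
rewrite /fobj -sumsq_vectorize; congr (_ * sumsq _).
apply/matrixP => i l; rewrite !mxE /= !ffunE cpdE ord1; congr (_ - _).
by apply: eq_bigr => r _; rewrite !mxE /= ffunE !mxE.
Qed.

End Unfolding.

(** * Decrease of the objective over one pass of the algorithm *)

Section Descent.
Variables (R : realType) (I J K N : nat) (A : tensor R I J K) (lambda s : R).
Hypotheses (lambda_gt0 : 0 < lambda) (s_gt1 : 1 < s).

(** The value of [Psi] where the indicators vanish, so that the descent argument stays in the
    reals. *)
Definition finite_Psi (X : 'M[R]_(I, N)) (Y : 'M[R]_(J, N)) (Z : 'M[R]_(K, N))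
    (alpha : 'rV[R]_N) : R :=
  fobj A X Y Z alpha + gobj lambda alpha.

Lemma PsiE X Y Z alpha : unit_cols X -> unit_cols Y -> unit_cols Z ->
  Psi A lambda (X, Y, Z, alpha) = (finite_Psi X Y Z alpha)%:E.
Proof.
by move=> X1 Y1 Z1; rewrite /Psi /indicator !mem_set // !adde0 -EFinD.
Qed.

Lemma gobj_ge0 (alpha : 'rV[R]_N) : 0 <= gobj lambda alpha.
Proof. by rewrite mulr_ge0 ?(ltW lambda_gt0) // sumr_ge0. Qed.

Lemma fobj_ge0 (X : 'M[R]_(I, N)) (Y : 'M[R]_(J, N)) (Z : 'M[R]_(K, N)) alpha :
  0 <= fobj A X Y Z alpha.
Proof. by rewrite mulr_ge0 ?invr_ge0 ?sqr_ge0. Qed.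

(* Normalizing the columns of a gradient step is its projection onto
   [unit_cols], i.e. the prox of the indicator function. *)
Lemma projected_gradient_descent (m n q : nat) (h : 'M[R]_(m, n) -> R)
    (B : 'M[R]_(m, q)) (U : 'M[R]_(n, q)) (M M' : 'M[R]_(m, n))
    (D := M - (s * Num.max (frob (U *m U^T)) 1)^-1 *: grad h M) :
    (forall M, h M = 2^-1 * sumsq (B - M *m U)) -> unit_cols M ->
    nonzero_cols D -> M' = normalize_cols D ->
  h M' + (s - 1) / 2 * sumsq (M - M') <= h M.
Proof.
move=> hE M1 D0 ->.
(* Both points have unit columns, so both indicator values are 0 and the prox condition becomes a
   comparison of distances to [D]. *)
have := prox_descent (g := 0) (g' := 0) hE s_gt1
  (M := M) (M' := normalize_cols D).
rewrite !addr0 !add0r; apply; rewrite ler_wpM2l ?normalize_cols_nearest //.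
rewrite !mulr_ge0 ?invr_ge0 ?le_max ?ler01 ?orbT //.
by rewrite ltW // (lt_trans ltr01 s_gt1).
Qed.

Lemma lrat_step_unit_cols (X X' : 'M[R]_(I, N)) (Y Y' : 'M[R]_(J, N))
    (Z Z' : 'M[R]_(K, N)) alpha alpha' :
    lrat_step A lambda s X Y Z alpha X' Y' Z' alpha' ->
  [/\ unit_cols X', unit_cols Y' & unit_cols Z'].
Proof.
by case=> -[D0 ->] [E0 ->] [F0 ->] _; split; apply: normalize_cols_unit.
Qed.

(** The four block inequalities chain: each update starts where the previous one ended, and the l1
    term changes only in the last. *)
Lemma lrat_step_descent (X : 'M[R]_(I, N)) (Y : 'M[R]_(J, N))
    (Z : 'M[R]_(K, N)) alpha X' Y' Z' alpha' :
    unit_cols X -> unit_cols Y -> unit_cols Z ->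
    lrat_step A lambda s X Y Z alpha X' Y' Z' alpha' ->
  finite_Psi X' Y' Z' alpha' +
    (s - 1) / 2 * (sumsq (X - X') + sumsq (Y - Y') + sumsq (Z - Z') +
                   sumsq (alpha - alpha'))
  <= finite_Psi X Y Z alpha.
Proof.
move=> X1 Y1 Z1 [[D0 X'E] [E0 Y'E] [F0 Z'E] alpha'E].
have dX := projected_gradient_descent
  (fun M => fobj_unfold1 A M Y Z alpha) X1 D0 X'E.
have dY := projected_gradient_descent
  (fun M => fobj_unfold2 A X' M Z alpha) Y1 E0 Y'E.
have dZ := projected_gradient_descent
  (fun M => fobj_unfold3 A X' Y' M alpha) Z1 F0 Z'E.
have dalpha := prox_descent (g := gobj lambda alpha) (g' := gobj lambda alpha')
  (fun a => fobj_vectorize A X' Y' Z' a) s_gt1 (M := alpha) (M' := alpha').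
have {}dalpha : fobj A X' Y' Z' alpha' + gobj lambda alpha' +
    (s - 1) / 2 * sumsq (alpha - alpha') <=
    fobj A X' Y' Z' alpha + gobj lambda alpha.
  apply: dalpha; rewrite alpha'E; apply: soft_prox_l1; first exact: ltW.
  by rewrite mulr_gt0 ?lt_max ?ltr01 ?orbT // (lt_trans ltr01 s_gt1).
rewrite /finite_Psi; lra.
Qed.

Lemma sumsq_unit_cols (m n : nat) (M : 'M[R]_(m, n)) :
  unit_cols M -> sumsq M = n%:R.
Proof.
move=> M1; rewrite sumsq_cols -[n in RHS]card_ord -sumr_const.
by apply: eq_bigr => r _; rewrite -frob_sqr M1 expr1n.
Qed.

End Descent.

(** * Vanishing increments and boundedness of the iterates *)

Lemma frob_cvg0 (R : realType) (m n : nat) (M : nat -> 'M[R]_(m, n))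
    (u : nat -> R) : (forall k, sumsq (M k) <= u k) ->
  u @ \oo --> (0 : R) -> (fun k => frob (M k)) @ \oo --> (0 : R).
Proof.
move=> Mu u0; apply: (@squeeze_cvgr _ _ _ _ (cst 0) (fun k => Num.sqrt (u k))).
- by apply: nearW => k; rewrite frob_ge0 ler_wsqrtr.
- exact: cvg_cst.
- rewrite -[X in _ --> X](@sqrtr0 R).
  exact: (continuous_cvg _ (@sqrt_continuous R 0) u0).
Qed.

Theorem lemma4p4 (R : realType) (I J K N : nat) (A : tensor R I J K)
    (lambda s : R) (X : nat -> 'M[R]_(I, N)) (Y : nat -> 'M[R]_(J, N))
    (Z : nat -> 'M[R]_(K, N)) (alpha : nat -> 'rV[R]_N)
    (w := fun n => (X n, Y n, Z n, alpha n))
    (N_gt0 : (0 < N)%N) (rankA : (tensor_rank A <= N)%N)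
    (lambda_gt0 : 0 < lambda) (s_gt1 : 1 < s)
    (gen : lrat_sequence A lambda s X Y Z alpha) :
  [/\ nonincreasing_seq (fun n => Psi A lambda (w n)) /\
      (forall n, exists2 beta : R, 0 < beta &
        ((beta * frob_point (w n - w n.+1) ^+ 2)%:E
           <= Psi A lambda (w n) - Psi A lambda (w n.+1))%E),
      [/\ (fun n => frob (X n - X n.+1)) @ \oo --> (0 : R),
          (fun n => frob (Y n - Y n.+1)) @ \oo --> (0 : R),
          (fun n => frob (Z n - Z n.+1)) @ \oo --> (0 : R)
        & (fun n => frob (alpha n - alpha n.+1)) @ \oo --> (0 : R)]
    & exists M : R, forall n, frob_point (w n) <= M].
Proof.
have [X01 Y01 Z01 step] := gen; rewrite !inE in X01 Y01 Z01.
have unit n : [/\ unit_cols (X n), unit_cols (Y n) & unit_cols (Z n)].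
  by case: n => [|n]; [split | exact: lrat_step_unit_cols (step n)].
pose phi n := finite_Psi A lambda (X n) (Y n) (Z n) (alpha n).
have PsiE n : Psi A lambda (w n) = (phi n)%:E.
  by have [X1 Y1 Z1] := unit n; exact: PsiE.
pose b := (s - 1) / 2.
have b_gt0 : 0 < b by rewrite /b; lra.
pose delta n := sumsq (X n - X n.+1) + sumsq (Y n - Y n.+1) +
  sumsq (Z n - Z n.+1) + sumsq (alpha n - alpha n.+1).
have descent n : b * delta n <= phi n - phi n.+1.
  have [X1 Y1 Z1] := unit n.
  by have := lrat_step_descent lambda_gt0 s_gt1 X1 Y1 Z1 (step n);
    rewrite lerBrDl.
have delta_ge0 n : 0 <= delta n by rewrite !addr_ge0 ?sumsq_ge0.
have phi_decr : nonincreasing_seq phi.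
  apply/nonincreasing_seqP => n; rewrite -subr_ge0.
  by apply: le_trans (descent n); rewrite mulr_ge0 // ltW.
have phi_ge0 n : 0 <= phi n by rewrite addr_ge0 ?fobj_ge0 ?gobj_ge0.
(* [phi] is nonincreasing and bounded below by 0, so it converges, and its shift has the same
   limit. *)
have delta0 : (fun n => (phi n - phi n.+1) / b) @ \oo --> (0 : R).
  have phi_cvg : cvgn phi.
    by apply: nonincreasing_is_cvgn => //; exists 0 => _ [n _ <-].
  rewrite -(mul0r b^-1) -(subrr (limn phi)); apply: cvgMl.
  by apply: cvgB => //; rewrite (cvg_shiftS phi).
have delta_le n : delta n <= (phi n - phi n.+1) / b.
  by rewrite ler_pdivlMr // mulrC.
split.
- split=> [n m nm|n]; first by rewrite !PsiE lee_fin phi_decr.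
  exists b => //; rewrite !PsiE -EFinB lee_fin.
  by rewrite /frob_point /= sqr_sqrtr ?descent ?delta_ge0.
- by split; apply: frob_cvg0 delta0 => n; apply: le_trans (delta_le n);
    rewrite /delta; move: (sumsq_ge0 (X n - X n.+1)) (sumsq_ge0 (Y n - Y n.+1))
    (sumsq_ge0 (Z n - Z n.+1)) (sumsq_ge0 (alpha n - alpha n.+1)); lra.
(* Each factor matrix has [N] unit columns, hence squared norm [N]; the last term bounds the squared
   l1 norm of the weights. *)
- exists (Num.sqrt (N%:R + N%:R + N%:R + (phi 0%N / lambda) ^+ 2)) => n.
  have [X1 Y1 Z1] := unit n; rewrite /frob_point /= ler_wsqrtr //.
  rewrite (sumsq_unit_cols X1) (sumsq_unit_cols Y1) (sumsq_unit_cols Z1) lerD2l.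
  apply: le_trans (sumsq_rowV_le_l1norm _) _.
  have l1_ge0 : 0 <= l1norm (alpha n) by rewrite sumr_ge0.
  rewrite ler_pXn2r ?nnegrE ?divr_ge0 ?(ltW lambda_gt0) // ler_pdivlMr // mulrC.
  apply: le_trans (phi_decr 0%N n _) => //.
  by rewrite /phi /finite_Psi lerDr fobj_ge0.
Qed.
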